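(* Fix constants $\delta>0$, $0<\epsilon<1/2$ and a positive integer $\Delta$. There exist a constant $C=C(\delta,\epsilon,\Delta)$ and a function $\eta(n)\to 0$ as $n\to\infty$ (depending only on $\delta,\epsilon,\Delta$) such that the following holds. Let $n\ge 2$ and let $G$ be a $\delta$-good expander on $n$ vertices with maximum degree at most $\Delta$. Then in the noisy corruption detection game on $G$ with noise parameter $\epsilon$ there is a strategy for the player making at most $C\,n\log n$ queries such that, for every partition $V(G)=T\sqcup B$ into truthful vertices $T$ and corrupt vertices $B$ with $|T|-|B|=1$, and for every behaviour of the corrupt vertices, with probability at least $1-\eta(n)$ the player outputs a set $T'\subseteq T$ with $|T'|\ge (1-2\delta)|T|$.
   Context: Noisy corruption detection game with noise parameter $\epsilon$: a finite simple connected graph $G$ on $n$ vertices is known to the player, and $V(G)=T\sqcup B$ is a partition, unknown to the player, into truthful vertices $T$ and corrupt vertices $B$. A query consists of choosing an ordered pair $(u,v)$ of adjacent vertices and asking $u$ whether its neighbor $v$ is truthful or corrupt; the same pair may be queried many times, and the answers may differ. Each time a truthful vertex $u$ is queried, it gives the correct answer with probability $1-\epsilon$ and the incorrect answer with probability $\epsilon$, independently over all queries. Corrupt vertices answer adversarially (arbitrarily). A $\delta$-good expander (for a constant $\delta>0$) is a graph $G$ with $|V(G)|=n$ such that (i) every nonempty $U\subset V(G)$ with $|U|\le 2\delta n$ has more than $|U|$ neighbors outside $U$, and (ii) for all $U,W\subset V(G)$ with $|U|\ge\delta n$ and $|W|\ge n/4$ there is an edge between some vertex of $U$ and some vertex of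 $W$. *)

(* Defs.v *)
From mathcomp Require Import all_boot all_order all_algebra.
From mathcomp Require Import reals.

Set Implicit Arguments.
Unset Strict Implicit.
Unset Printing Implicit Defensive.

Import Order.TTheory GRing.Theory Num.Theory.

Local Open Scope ring_scope.

Section Graph.
Variables (R : realType) (V : finType) (e : rel V).

Definition simple_graph : Prop := symmetric e /\ irreflexive e.

Definition connected_graph : Prop := forall u v : V, connect e u v.

Definition max_degree_le (Delta : nat) : Prop :=
  forall v : V, (#|[set w | e v w]| <= Delta)%N.

Definition outer_nbrs (U : {set V}) : {set V} :=
  [set v | v \notin U & [exists u in U, e u v]].

Definition good_expander (delta : R) : Prop :=
  (forall U : {set V}, U != set0 ->
     #|U|%:R <= 2 * delta * #|V|%:R -> (#|U| < #|outer_nbrs U|)%N) /\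
  (forall U W : {set V},
     delta * #|V|%:R <= #|U|%:R -> #|V|%:R / 4 <= #|W|%:R :> R ->
     exists u w : V, [/\ u \in U, w \in W & e u w]).

End Graph.

Section Game.
Variables (R : realType) (V : finType) (e : rel V).

(* An adaptive strategy is a finite decision tree.  [Query u v _ k] asks [u]  *)
(* about its neighbour [v] and continues with [k a] on answer [a], where      *)
(* [a = true] means that [u] declares [v] truthful.                           *)
Inductive strategy : Type :=
| Output of {set V}
| Query (u v : V) of e u v & (bool -> strategy).

(* Worst-case number of queries. *)
Fixpoint num_queries (s : strategy) : nat :=
  match s with
  | Output _ => 0%N
  | Query _ _ _ k => (maxn (num_queries (k true)) (num_queries (k false))).+1
  end.

(* The queries asked so far, oldest first, each with the answer received. *)
Definition history : Type := seq (V * V * bool).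

(* [b h u v] is the probability that a corrupt [u], asked about [v] after the *)
(* history [h], answers "truthful".  The corrupt vertices thus see the whole  *)
(* transcript and may collude and randomize; values in {0, 1} give the        *)
(* deterministic behaviours.                                                  *)
Definition behaviour : Type := history -> V -> V -> R.

Definition valid_behaviour (b : behaviour) : Prop :=
  forall h u v, 0 <= b h u v <= 1.

Section Play.
Variables (epsilon : R) (T : {set V}) (b : behaviour).

Definition prob_says_truthful (h : history) (u v : V) : R :=
  if u \in T then (if v \in T then 1 - epsilon else epsilon) else b h u v.

(* Probability that the set output by [s], started after [h], satisfies [W].  *)
(* Each query uses fresh randomness: given the past, its answer is Bernoulli  *)
(* with parameter [prob_says_truthful h u v].                                 *)
Fixpoint prob_output (W : pred {set V}) (s : strategy) (h : history) : R :=
  match s with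
  | Output T' => (W T')%:R
  | Query u v _ k =>
      prob_says_truthful h u v
        * prob_output W (k true) (rcons h (u, v, true))
      + (1 - prob_says_truthful h u v)
        * prob_output W (k false) (rcons h (u, v, false))
  end.

End Play.

Definition successful (delta : R) (T : {set V}) : pred {set V} :=
  fun T' => (T' \subset T) && ((1 - 2 * delta) * #|T|%:R <= #|T'|%:R).

End Game.

(* Main.v *)
(* Every directed edge is queried [2k] times with [k] of order [log n], and   *)
(* the answers are replaced by their majority.  With probability at least     *)
(* [1 - 1/n] the majorities at truthful vertices are all correct, so that [T] *)
(* is among the candidates: sets of [(n+1)/2] vertices whose members answer   *)
(* about each neighbour whether it is in the set.  Two candidates agree on    *)
(* the neighbours of common members, so no edge joins an intersection of [T]  *)
(* with other candidates to the rest of [T].                                  *)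
(* Expansion of small sets makes two candidates meet in more than             *)
(* [2 delta n] vertices, and then condition (ii), applied as candidates are   *)
(* intersected one by one, shows that the intersection of all of them misses  *)
(* less than [delta n <= 2 delta |T|] vertices of [T].                        *)
Require Import Defs.
From mathcomp Require Import all_boot all_order all_algebra.
From mathcomp Require Import all_classical all_reals all_analysis.
From mathcomp Require Import ring lra zify.
Import Order.TTheory GRing.Theory Num.Theory.
Import numFieldNormedType.Exports.
Local Open Scope ring_scope.

(** Decoding is deterministic: once [T] is a candidate, [consistent_core_successful] follows from
    expansion alone. The probabilistic half must allow corrupt vertices that react to the whole
    transcript, so the answers are not independent. It uses a union bound carried by a martingale:
    [noise_potential] sums one likelihood ratio per pair with truthful source, and corrupt answers
    leave it unchanged. It starts at no more than n^2, and a wrong majority forces it up to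
    rho^(-k), where rho = 4 epsilon (1 - epsilon) < 1 ([likelihood_ratio_ge]). By
    [prob_output_ask_ge] failure has probability at most rho^k n^2, which is at most 1/n for k of
    order log n. *)

(** * Deterministic decoding by expansion *)

Section Decoding.
Context {R : realType} {V : finType} (e : rel V).
Import mathcomp.boot.finset.
Set Implicit Arguments.
Unset Strict Implicit.

Definition consistent (r : rel V) (S : {set V}) : bool :=
  (#|S| + #|S| == #|V|.+1)%N &&
  [forall u in S, forall v, e u v ==> (r u v == (v \in S))].

(** Computable from the answers alone, hence a legal output. Without candidates it is the whole of
    [V], which can happen only if [T] itself is not consistent. *)
Definition consistent_core (r : rel V) : {set V} :=
  [set x | [forall (S | consistent r S), x \in S]].

Lemma consistent_card (r : rel V) (S : {set V}) :
  consistent r S -> (#|S| + #|S|)%N = #|V|.+1.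
Proof. by case/andP=> /eqP. Qed.

Lemma consistent_answer (r : rel V) (S : {set V}) (u v : V) :
  consistent r S -> u \in S -> e u v -> r u v = (v \in S).
Proof.
case/andP=> _ /forall_inP H uS euv.
by apply/eqP; have /forallP /(_ v) := H u uS; rewrite euv.
Qed.

(* Vertices of [S :&: S'] have all their outside neighbours outside           *)
(* [S :|: S'], which has only [#|S :&: S'| - 1] elements in its complement.   *)
Lemma consistent_inter_gt (delta : R) (r : rel V) (S S' : {set V}) :
  good_expander e delta -> consistent r S -> consistent r S' ->
  2 * delta * #|V|%:R < #|S :&: S'|%:R :> R.
Proof.
move=> [expand _] cS cS'; rewrite ltNge; apply/negP => small.
have cardU := cardsUI S S'.
have cardC := cardsC (S :|: S').
have [cS1 cS2] := (consistent_card cS, consistent_card cS').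
have leU : (#|S :|: S'| <= #|V|)%N by exact: max_card.
have I0 : (S :&: S')%SET != set0 by rewrite -card_gt0; lia.
have := expand _ I0 small.
suff : (#|outer_nbrs e (S :&: S')| <= #|~: (S :|: S')|)%N by lia.
apply: subset_leq_card; apply/fintype.subsetP => v.
rewrite !inE => /andP[vI /exists_inP[u]].
rewrite inE => /andP[uS uS'] euv; move: vI.
rewrite -(consistent_answer cS uS euv) -(consistent_answer cS' uS' euv).
by rewrite andbb orbb.
Qed.

(** No edge joins [J] to the rest of [T]. Condition (ii) with [J] as the set of size at least delta
    n leaves fewer than n/4 vertices in the rest; so [J] has at least n/4, and (ii) with the roles
    exchanged applies. *)
Lemma closed_part_large (delta : R) (T J : {set V}) :
  symmetric e -> good_expander e delta -> (#|V| <= #|T| + #|T|)%N ->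
  J \subset T -> (forall u v, u \in J -> v \in T -> e u v -> v \in J) ->
  delta * #|V|%:R <= #|J|%:R -> #|T :\: J|%:R < delta * #|V|%:R.
Proof.
move=> sym_e [_ cross] cardT JT closedJ largeJ.
have cardD : (#|J| + #|T :\: J|)%N = #|T|.
  by rewrite -(cardsID J T) (setIidPr JT).
have cardR : (#|V|%:R <= (#|J|%:R + #|T :\: J|%:R) *+ 2 :> R).
  by rewrite -natrD cardD mulr2n -natrD ler_nat.
have small : #|T :\: J|%:R < #|V|%:R / 4 :> R.
  rewrite ltNge; apply/negP => big.
  have [u [w [uJ]]] := cross _ _ largeJ big.
  rewrite inE => /andP[wJ wT] euw.
  by rewrite (closedJ u w) in wJ.
rewrite ltNge; apply/negP => big.
have bigJ : #|V|%:R / 4 <= #|J|%:R :> R by move: cardR small; lra.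
have [w [u [+ uJ ewu]]] := cross _ _ big bigJ.
rewrite inE => /andP[wJ wT].
by rewrite (closedJ u w) // sym_e in wJ.
Qed.

Lemma consistent_inter_large (delta : R) (r : rel V) (T : {set V})
    (l : seq {set V}) :
  0 < delta -> symmetric e -> good_expander e delta ->
  consistent r T -> all (consistent r) l ->
  #|T :\: [set x in T | all (fun S : {set V} => x \in S) l]|%:R
    < delta * #|V|%:R.
Proof.
move=> delta0 sym_e exp_e cT; have cardT := consistent_card cT.
have n_gt0 : (0 < #|V|)%N by have := max_card T; lia.
elim: l => [|S l IHl] /=.
  rewrite (_ : [set x in T | true] = T); last first.
    by apply/setP => x; rewrite inE andbT.
  by rewrite setDv cards0 mulr_gt0 // ltr0n.
case/andP=> cS cl; have {IHl}smallD := IHl cl.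
have cSl : all (consistent r) (S :: l) by rewrite /= cS.
apply: closed_part_large => //; first by lia.
- by apply/fintype.subsetP => x; rewrite inE => /andP[].
- move=> u v; rewrite !inE => /andP[uT uSl] vT euv; rewrite vT /=.
  apply/(@allP _ _ (S :: l)) => S' S'l.
  have cS' := allP cSl _ S'l.
  have uS' : u \in S' := @allP _ _ (S :: l) uSl _ S'l.
  by rewrite -(consistent_answer cS' uS' euv) (consistent_answer cT uT euv).
(* [T :&: S] has more than 2 delta n vertices, and fewer than delta n of them lie outside the
   previous intersection [J]. *)
- have := consistent_inter_gt exp_e cT cS.
  set J := [set x in T | _] in smallD *; set K := [set x in T | _].
  have : (#|T :&: S| <= #|K| + #|T :\: J|)%N.
    apply: (@leq_trans #|K :|: (T :\: J)|); last by rewrite leq_card_setU.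
    apply: subset_leq_card; apply/fintype.subsetP => x; rewrite !inE.
    by case: (x \in T); case: (x \in S); case: (all _ l).
  rewrite -(ler_nat R) natrD; move: smallD; lra.
Qed.

Lemma consistent_core_successful (delta : R) (r : rel V) (T : {set V}) :
  0 < delta -> symmetric e -> good_expander e delta -> consistent r T ->
  successful delta T (consistent_core r).
Proof.
move=> delta0 sym_e exp_e cT; rewrite /successful.
have coreT : consistent_core r \subset T.
  by apply/fintype.subsetP => x; rewrite inE => /forall_inP /(_ T cT).
have all_l : all (consistent r) (enum (consistent r)).
  by apply/allP => S; rewrite mem_enum.
have := consistent_inter_large delta0 sym_e exp_e cT all_l.
rewrite (_ : [set x in T | _] = consistent_core r); last first.
  apply/setP => x; rewrite !inE; apply/andP/forall_inP => [[_ /allP xl] S cS|xl].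
    by apply: xl; rewrite mem_enum.
  split; first exact: xl.
  by apply/allP => S; rewrite mem_enum; exact: xl.
rewrite coreT /=.
have cardD : (#|consistent_core r| + #|T :\: consistent_core r|)%N = #|T|.
  by rewrite -(cardsID (consistent_core r) T) (setIidPr coreT).
have : (#|V|%:R + 1 = #|T|%:R + #|T|%:R :> R).
  by rewrite natr1 -natrD (consistent_card cT).
rewrite -cardD natrD; nra.
Qed.

End Decoding.

(** * Fixed query schedules against an adaptive adversary *)

Section Sampling.
Context {R : realType} {V : finType} {e : rel V}.
Set Implicit Arguments.
Unset Strict Implicit.

Definition directed_edge : Type := {p : V * V | e p.1 p.2}.

Fixpoint ask (F : history V -> {set V}) (l : seq directed_edge)
    (h : history V) : strategy e :=
  match l with
  | [::] => Output e (F h)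
  | q :: l' =>
      Query (valP q) (fun a => ask F l' (rcons h ((val q).1, (val q).2, a)))
  end.

Lemma num_queries_ask F l h : num_queries (ask F l h) = size l.
Proof. by elim: l h => [//|q l IHl] h /=; rewrite !IHl maxnn. Qed.

(** A supermartingale that dominates the failure indicator at the leaves dominates the failure
    probability at the root, by induction on the schedule. *)
Lemma prob_output_ask_ge (epsilon : R) (T : {set V}) (b : behaviour R V)
    (W : pred {set V}) (F : history V -> {set V}) (Phi : history V -> R)
    (l : seq directed_edge) (h : history V) :
  0 <= epsilon <= 1 -> valid_behaviour b ->
  (forall h' u v, let p := prob_says_truthful epsilon T b h' u v in
     p * Phi (rcons h' (u, v, true)) + (1 - p) * Phi (rcons h' (u, v, false))
       <= Phi h') ->
  (forall h', map fst h' = map fst h ++ map val l ->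
     1 - (W (F h'))%:R <= Phi h') ->
  1 - Phi h <= prob_output epsilon T b W (ask F l h) h.
Proof.
move=> eps01 valid_b super; elim: l h => [|q l IHl] h leaf /=.
  by have := leaf h; rewrite cats0 => /(_ erefl); lra.
set p := prob_says_truthful _ _ _ _ _ _.
have p01 : 0 <= p <= 1.
  rewrite /p /prob_says_truthful; case: ifP => _; last exact: valid_b.
  by case: ifP => _; move: eps01; lra.
have branch a : 1 - Phi (rcons h ((val q).1, (val q).2, a)) <=
    prob_output epsilon T b W (ask F l (rcons h ((val q).1, (val q).2, a)))
      (rcons h ((val q).1, (val q).2, a)).
  apply: IHl => h' h'E; apply: leaf; rewrite h'E map_rcons cat_rcons /=.
  by rewrite -surjective_pairing.
have := super h (val q).1 (val q).2; rewrite -/p /=.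
have := branch true; have := branch false.
move: (prob_output _ _ _ _ _ _) => x; move: (prob_output _ _ _ _ _ _) => y.
move: (Phi _) => x'; move: (Phi _) => y'; move: (Phi _) => z.
by nra.
Qed.

End Sampling.

(** * Majority votes and the noise martingale *)

Section Majority.
Context {R : realType} {V : finType} {e : rel V}.
Variables (epsilon : R) (T : {set V}).
Set Implicit Arguments.
Unset Strict Implicit.

(** Meant for 2k answers per pair; a tie reads as corrupt, and the analysis counts every tie as an
    error. *)
Definition majority (k : nat) (h : history V) : rel V :=
  fun u v => (k < count_mem (u, v, true) h)%N.

Lemma count_answers (h : history V) (u v : V) (a : bool) :
  (count_mem (u, v, a) h + count_mem (u, v, ~~ a) h)%N
    = count_mem (u, v) (map fst h).
Proof.
elim: h => //= -[uv c] h <- /=; rewrite addnACA; congr (_ + _)%N.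
by rewrite !(xpair_eqE uv); case: (uv == _); case: a; case: c.
Qed.

(* Likelihood ratio of a fair coin against the noise of a truthful vertex,    *)
(* evaluated on the answers of [uv.1] about [uv.2]; it is a martingale.       *)
Definition likelihood_ratio (h : history V) (uv : V * V) : R :=
  (2 * epsilon)^-1 ^+ count_mem (uv, uv.2 \notin T) h *
  (2 * (1 - epsilon))^-1 ^+ count_mem (uv, uv.2 \in T) h.

(** Nonadjacent pairs are included: they are never queried and contribute 1. *)
Definition noise_potential (h : history V) : R :=
  \sum_(uv : V * V | uv.1 \in T) likelihood_ratio h uv.

Hypotheses (epsilon_gt0 : 0 < epsilon) (epsilon_lt : epsilon < 1 / 2).

Lemma likelihood_ratio_ge0 h uv : 0 <= likelihood_ratio h uv.
Proof.
by rewrite mulr_ge0 // exprn_ge0 // invr_ge0; move: epsilon_gt0 epsilon_lt; lra.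
Qed.

(** Only the term of the queried pair can change, and it is present only for truthful [u]; its mean
    factor is then epsilon / (2 epsilon) + (1 - epsilon) / (2 (1 - epsilon)) = 1. *)
Lemma noise_potential_martingale (b : behaviour R V) h u v :
  let p := prob_says_truthful epsilon T b h u v in
  p * noise_potential (rcons h (u, v, true))
    + (1 - p) * noise_potential (rcons h (u, v, false)) = noise_potential h.
Proof.
move=> p; rewrite /noise_potential !mulr_sumr -big_split /=.
apply: eq_bigr => -[u' v'] /= u'T.
have [[eu ev]|neq] := eqVneq (u', v') (u, v); last first.
  suff same a : likelihood_ratio (rcons h (u, v, a)) (u', v')
      = likelihood_ratio h (u', v') by rewrite !same -mulrDl; lra.
  rewrite /likelihood_ratio -cats1 !count_cat /= !(xpair_eqE (u, v)).
  by rewrite [(u, v) == _]eq_sym (negbTE neq) /= !addn0.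
have eps_neq0 : epsilon != 0 by move: epsilon_gt0; lra.
have eps1_neq0 : 1 - epsilon != 0 by move: epsilon_lt; lra.
move: u'T; rewrite {}eu {}ev => uT.
rewrite /likelihood_ratio -!cats1 !count_cat /= !xpair_eqE !eqxx /=.
rewrite /p /prob_says_truthful uT; case: (v \in T) => /=;
  rewrite ?addn0 ?addn1 !exprS; field; exact/andP.
Qed.

(** As epsilon < 1/2, wrong answers raise the ratio and right ones lower it, so the extreme case is
    a tie, where the ratio is exactly (4 epsilon (1 - epsilon))^(-k). *)
Lemma likelihood_ratio_ge (k : nat) h uv :
  count_mem uv (map fst h) = k.*2 -> (k <= count_mem (uv, uv.2 \notin T) h)%N ->
  1 <= (4 * epsilon * (1 - epsilon)) ^+ k * likelihood_ratio h uv.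
Proof.
case: uv => u v /= total wrong.
have := count_answers h u v (v \in T); rewrite {}total => total.
rewrite /likelihood_ratio /=; set x := (2 * epsilon)^-1.
set y := (2 * (1 - epsilon))^-1.
have eps_neq0 : epsilon != 0 by move: epsilon_gt0; lra.
have eps1_neq0 : 1 - epsilon != 0 by move: epsilon_lt; lra.
have x_ge1 : 1 <= x.
  by rewrite invf_ge1; move: epsilon_gt0 epsilon_lt; lra.
have y_ge0 : 0 <= y by rewrite invr_ge0; move: epsilon_lt; lra.
have y_le1 : y <= 1 by rewrite invf_le1; move: epsilon_lt; lra.
have rho_ge0 : 0 <= 4 * epsilon * (1 - epsilon).
  by rewrite !mulr_ge0 //; move: epsilon_gt0 epsilon_lt; lra.
rewrite [leLHS](_ : 1 = (4 * epsilon * (1 - epsilon)) ^+ k * (x ^+ k * y ^+ k)); last first.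
  rewrite -!exprMn (_ : _ * (x * y) = 1) ?expr1n // /x /y; field; exact/andP.
apply: ler_wpM2l; first exact: exprn_ge0.
apply: ler_pM; rewrite ?exprn_ge0 //; first exact: le_trans x_ge1.
  exact: (ler_weXn2l x_ge1).
apply: (ler_wiXn2l y_ge0 y_le1).
by rewrite -(leq_add2r (count_mem (u, v, v \notin T) h)) total -addnn leq_add2l.
Qed.

Lemma majority_consistent (k : nat) (h : history V) :
  (#|T| + #|T|)%N = #|V|.+1 ->
  (forall u v, e u v -> count_mem (u, v) (map fst h) = k.*2) ->
  (forall u v, e u v -> u \in T -> (count_mem (u, v, v \notin T) h < k)%N) ->
  consistent e (majority k h) T.
Proof.
move=> cardT total few; rewrite /consistent cardT eqxx /=.
apply/forall_inP => u uT; apply/forallP => v; apply/implyP => euv.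
have := count_answers h u v (v \in T); rewrite total // /majority.
have := few u v euv uT; case: (v \in T) => /=; last by lia.
by rewrite [_ == true]eqb_id; lia.
Qed.

(** Either some truthful majority fails and its single term is already at least 1, or [T] is
    consistent and the left side is 0. *)
Lemma majority_core_failure (delta : R) (k : nat) (h : history V) :
  0 < delta -> symmetric e -> good_expander e delta ->
  (#|T| + #|T|)%N = #|V|.+1 ->
  (forall u v, e u v -> count_mem (u, v) (map fst h) = k.*2) ->
  1 - (successful delta T (consistent_core e (majority k h)))%:R
    <= (4 * epsilon * (1 - epsilon)) ^+ k * noise_potential h.
Proof.
move=> delta0 sym_e exp_e cardT total.
have rho_ge0 : 0 <= 4 * epsilon * (1 - epsilon).
  by rewrite !mulr_ge0 //; move: epsilon_gt0 epsilon_lt; lra.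
rewrite /noise_potential mulr_sumr.
have term_ge0 uv : 0 <= (4 * epsilon * (1 - epsilon)) ^+ k * likelihood_ratio h uv.
  by rewrite mulr_ge0 ?exprn_ge0 ?likelihood_ratio_ge0.
have [/existsP[[u v] /and3P[/= euv uT wrong]]|] := boolP
    [exists uv : V * V, [&& e uv.1 uv.2, uv.1 \in T &
                          (k <= count_mem (uv, uv.2 \notin T) h)%N]].
  rewrite (bigD1 (u, v)) //= -[leLHS]addr0 lerD //; last exact: sumr_ge0.
  apply: le_trans (likelihood_ratio_ge _ wrong); last exact: total.
  by rewrite gerBl ler0n.
rewrite negb_exists => /forallP few.
rewrite (@consistent_core_successful _ _ _ delta _ T) ?subrr ?sumr_ge0 //.
apply: majority_consistent => // u v euv uT.
by have := few (u, v); rewrite /= euv uT /= -ltnNge.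
Qed.

End Majority.

(** * The query schedule and its length *)

Section Schedule.
Context {V : finType} (e : rel V).
Set Implicit Arguments.
Unset Strict Implicit.

Definition repeated_edges (m : nat) : seq (@directed_edge V e) :=
  flatten (nseq m (enum {: {p : V * V | e p.1 p.2}})).

Lemma size_repeated_edges (Delta m : nat) :
  max_degree_le e Delta -> (size (repeated_edges m) <= #|V| * Delta * m)%N.
Proof.
move=> deg; rewrite size_flatten /shape map_nseq sumn_nseq -cardE card_sig.
rewrite leq_mul2r -sum1_card; apply/orP; right.
rewrite -(pair_big_dep xpredT (fun u v => e u v) (fun _ _ => 1%N)) /=.
rewrite -sum_nat_const; apply: leq_sum => u _; rewrite sum1_card.
by rewrite (leq_trans _ (deg u)) // cardsE.
Qed.

Lemma count_repeated_edges (m : nat) (u v : V) :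
  e u v -> count_mem (u, v) (map val (repeated_edges m)) = m.
Proof.
move=> euv; rewrite count_map count_flatten map_nseq sumn_nseq.
pose q : {p : V * V | e p.1 p.2} := exist _ (u, v) euv.
rewrite (@eq_count _ _ (pred1 q)) => [|p]; last by rewrite /= -val_eqE.
by rewrite count_uniq_mem ?enum_uniq // mem_enum mul1n.
Qed.

End Schedule.

(** The cube yields n^(-3): two factors pay for the n^2 pairs, the third is the error. *)
Lemma exp_up_log_bound {R : realType} (x : R) (A n : nat) :
  0 <= x -> x ^+ A <= (2 ^+ 3)^-1 -> (0 < n)%N ->
  x ^+ (A * up_log 2 n) * n%:R ^+ 2 <= n%:R^-1.
Proof.
move=> x_ge0 xA n_gt0; have n0 : (0 < n%:R :> R) by rewrite ltr0n.
rewrite -ler_pdivlMr ?exprn_gt0 // -invfM -exprS exprM.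
apply: (@le_trans _ _ ((2 ^+ 3)^-1 ^+ up_log 2 n)).
  by rewrite lerXn2r // nnegrE ?exprn_ge0 // invr_ge0 exprn_ge0.
rewrite exprVn lef_pV2 ?posrE ?exprn_gt0 // -exprM mulnC exprM.
by rewrite lerXn2r ?nnegrE ?exprn_ge0 ?ler0n // -natrX ler_nat up_logP.
Qed.

(** Rounding up adds at most 1, which is at most log2 n. *)
Lemma up_log2_le_ln {R : realType} (n : nat) :
  (2 <= n)%N -> (up_log 2 n)%:R <= 2 / ln 2 * ln n%:R :> R.
Proof.
move=> n2; have ln2_gt0 : 0 < ln 2 :> R by rewrite ln_gt0 // ltr1n.
have L_gt0 : (0 < up_log 2 n)%N by rewrite up_log_gt0.
have : ln (2 ^+ (up_log 2 n).-1) <= ln n%:R :> R.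
  by rewrite ler_ln ?posrE ?exprn_gt0 ?ltr0n //; [rewrite -natrX ler_nat ltnW //
    up_log_gtn | exact: ltnW].
have : ln 2 <= ln n%:R :> R by rewrite ler_ln ?posrE ?ltr0n ?ler_nat // ltnW.
have -> : (up_log 2 n)%:R = (up_log 2 n).-1%:R + 1 :> R by rewrite natr1 prednK.
rewrite lnXn // -[ln 2 *+ _]mulr_natr mulrAC ler_pdivlMr // mulrDl mul1r [_ * ln 2]mulrC.
lra.
Qed.

Theorem theorem2p1 (R : realType) (delta epsilon : R) (Delta : nat)
    (delta_gt0 : 0 < delta) (epsilon_gt0 : 0 < epsilon)
    (epsilon_lt : epsilon < 1 / 2) (Delta_gt0 : (0 < Delta)%N) :
  exists (C : R) (eta : nat -> R),
    (eta n @[n --> \oo] --> (0 : R))%classic /\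
    forall (V : finType) (e : rel V),
      (2 <= #|V|)%N ->
      simple_graph e -> connected_graph e ->
      good_expander e delta -> max_degree_le e Delta ->
      exists s : strategy e,
        (num_queries s)%:R <= C * #|V|%:R * ln (#|V|%:R : R) /\
        forall T B : {set V},
          [disjoint T & B] -> T :|: B = [set: V]%SET -> #|T| = (#|B| + 1)%N ->
          forall b : behaviour R V, valid_behaviour b ->
            1 - eta #|V| <= prob_output epsilon T b (successful delta T) s [::].
Proof.
pose rho := 4 * epsilon * (1 - epsilon).
have rho_ge0 : 0 <= rho by rewrite /rho; nra.
have rho_lt1 : rho < 1 by rewrite /rho; nra.
have [A rhoA] : exists A, rho ^+ A <= (2 ^+ 3)^-1.
  have /cvgr_norm_le : (rho ^+ n @[n --> \oo] --> (0 : R))%classic.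
    by apply: cvg_expr; rewrite ger0_norm.
  move=> /(_ (2 ^+ 3)^-1); rewrite normr0 invr_gt0 exprn_gt0 // => /(_ isT).
  case=> N _ /(_ N (leqnn N)) /=; rewrite ger0_norm ?exprn_ge0 // => rhoN.
  by exists N.
(* At most n Delta directed edges are each queried 2 A [up_log 2 n] times; [A] depends on epsilon
   only. *)
exists (Delta%:R * (A.*2)%:R * (2 / ln 2)), (fun n => n%:R^-1); split.
  by rewrite -(cvg_shiftn 1); under eq_fun do rewrite addn1; exact: cvg_harmonic.
move=> V e n2 [sym_e _] _ exp_e deg.
pose k := (A * up_log 2 #|V|)%N.
exists (ask (fun h => consistent_core e (majority k h)) (repeated_edges e k.*2) [::]).
split.
  rewrite num_queries_ask.
  apply: (@le_trans _ _ (#|V| * Delta * k.*2)%:R).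
    by rewrite ler_nat size_repeated_edges.
  rewrite /k doubleMl !natrM.
  have coef_ge0 : 0 <= Delta%:R * A.*2%:R * #|V|%:R :> R by rewrite !mulr_ge0.
  have := ler_wpM2l coef_ge0 (up_log2_le_ln n2).
  by congr (_ <= _); ring.
move=> T B disTB TB cardTB b valid_b.
have cardT : (#|T| + #|T|)%N = #|V|.+1.
  by have := leq_card_setU T B; rewrite disTB TB cardsT => -[_ /eqP]; lia.
pose Phi h := rho ^+ k * noise_potential epsilon T h.
apply: (@le_trans _ _ (1 - Phi [::])).
  rewrite lerD2l lerN2; apply: le_trans (exp_up_log_bound rho_ge0 rhoA _); last by lia.
  apply: ler_wpM2l; first exact: exprn_ge0.
  rewrite /noise_potential /likelihood_ratio /=.
  under eq_bigr do rewrite !expr0 mulr1.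
  by rewrite sumr_const expr2 -natrM -card_prod ler_nat max_card.
apply: prob_output_ask_ge => //.
- by move: epsilon_gt0 epsilon_lt; lra.
- move=> h u v /=; rewrite /Phi mulrCA [X in _ + X]mulrCA -mulrDr.
  by rewrite noise_potential_martingale.
- move=> h hE; apply: majority_core_failure => // u v euv.
  by rewrite hE /= count_repeated_edges.
Qed.
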